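(* There is an absolute constant $C>0$ such that the following holds. Let $\mu$ be an arbitrary (possibly non-doubling) locally finite Borel measure on $\mathbb{R}^d$, let $f:\mathbb{R}^d\to\mathbb{R}$ be a measurable function, let $0<\lambda<1/2$, and let $F_0\in\mathcal{D}$ be a dyadic cube. For each dyadic cube $Q$ let $m(f;Q)$ be a (fixed) median of $f$ on $Q$. Then there exists a sparse collection $\mathcal{F}$ of dyadic subcubes of $F_0$ (depending on $F_0$ and $f$) such that $$ |f-m(f;\hat{F_0})|\,1_{F_0}\le C \sum_{F\in\mathcal{F}} \big(\omega_\lambda(f;F)+|m(f;F)-m(f;\hat{F})| \big)1_F $$ $\mu$-almost everywhere.
   Context: $\mathcal{D}$ denotes the collection of dyadic cubes of $\mathbb{R}^d$, and $\hat{Q}$ denotes the dyadic parent of a dyadic cube $Q$. For a collection $\mathcal{F}\subseteq\mathcal{D}$ and a cube $F$, $\mathrm{ch}_{\mathcal{F}}(F)$ denotes the collection of all maximal cubes $F'\in\mathcal{F}$ such that $F'\subsetneq F$. The collection $\mathcal{F}$ is called sparse (with respect to $\mu$) if there exists $\gamma\in(0,1)$ such that $\sum_{F'\in \mathrm{ch}_{\mathcal{F}}(F)}\mu(F')\le\gamma\,\mu(F)$ for every $F\in\mathcal{F}$. A median $m(f;Q)$ of $f$ on a cube $Q$ with $\mu(Q)>0$ is any real number such that $\mu(Q\cap\{f>m(f;Q)\})\le \tfrac12\mu(Q)$ and $\mu(Q\cap\{f<m(f;Q)\})\le\tfrac12\mu(Q)$. If $\mu(Q)=0$, then $m(f;Q)$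 is an arbitrary real number. The relative median oscillation of $f$ (about zero) on $Q$ is $r_\lambda(f;Q):=\min\{r\ge 0:\ \mu(Q\cap\{|f|>r\})\le\lambda\mu(Q)\}$, and the median oscillation of $f$ on $Q$ is $\omega_\lambda(f;Q):=\inf_{c\in\mathbb{R}} r_\lambda(f-c;Q)$. *)

(* Defs.v *)
From mathcomp Require Import all_boot all_order all_algebra.
From mathcomp Require Import all_classical all_reals all_analysis.
Set Implicit Arguments.
Unset Strict Implicit.
Unset Printing Implicit Defensive.
Import Order.TTheory GRing.Theory Num.Theory.
Import numFieldNormedType.Exports.
Local Open Scope classical_set_scope.
Local Open Scope ring_scope.

Definition borel_rV (R : realType) (d : nat) :=
  g_sigma_algebraType (@open 'rV[R]_d).

Definition locally_finite_measure (R : realType) (d : nat)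
    (mu : {measure set (borel_rV R d) -> \bar R}) : Prop :=
  forall x : 'rV[R]_d, exists2 U : set 'rV[R]_d, open_nbhs x U & (mu U < +oo)%E.

(* (k, n) stands for the cube 2^-k (n + [0,1)^d); for 0 < d this indexing of
   the dyadic cubes of R^d is one-to-one, see [cube_inj] below. *)
Definition dyadic (d : nat) : Type := (int * 'rV[int]_d)%type.

Definition cube (R : realType) (d : nat) (Q : dyadic d) : set 'rV[R]_d :=
  [set x | forall i : 'I_d,
     (Q.2 ord0 i)%:~R * (2 : R) ^ (- Q.1) <= x ord0 i
       < (Q.2 ord0 i + 1)%:~R * (2 : R) ^ (- Q.1)].

Arguments cube R {d} Q.

(* [divz] by 2 is floor division, also on negative integers. *)
Definition parent (d : nat) (Q : dyadic d) : dyadic d :=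
  (Q.1 - 1, \row_i (Q.2 ord0 i %/ 2)%Z).

Lemma cube_parent (R : realType) (d : nat) (Q : dyadic d) :
  cube R Q `<=` cube R (parent Q).
Proof.
move=> x Qx i; have /andP[lx xu] := Qx i; rewrite /= mxE.
set n := Q.2 ord0 i in lx xu *.
have -> : (2 : R) ^ (- (Q.1 - 1)) = 2 * 2 ^ (- Q.1).
  by rewrite opprB addrC expfzDr ?pnatr_eq0// expr1z mulrC.
have p0 : 0 < (2 : R) ^ (- Q.1) by rewrite exprz_gt0.
have en := divz_eq n 2.
have h0 : (0 <= n %% 2)%Z by exact: modz_ge0.
have h1 : (n %% 2 < 2)%Z by exact: ltz_pmod.
rewrite !mulrA -[2 : R]/(2%:~R) -!intrM; apply/andP; split.
  apply: le_trans lx; rewrite ler_pM2r// ler_int [leRHS]en.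
  by rewrite lerDl.
apply: lt_le_trans xu _; rewrite ler_pM2r// ler_int [in leLHS]en.
by rewrite mulrDl mul1r -addrA lerD2l lezD1.
Qed.

Lemma cube_inj (R : realType) (d : nat) : (0 < d)%N -> injective (@cube R d).
Proof.
move=> d0 Q Q' eQ.
have low : forall (P P' : dyadic d) i, cube R P = cube R P' ->
    (P'.2 ord0 i)%:~R * (2 : R) ^ (- P'.1) <= (P.2 ord0 i)%:~R * 2 ^ (- P.1).
  move=> P P' i eP.
  have : cube R P (\row_j ((P.2 ord0 j)%:~R * 2 ^ (- P.1))).
    by move=> j; rewrite mxE lexx ltr_pM2r ?exprz_gt0// ltr_int ltzD1/=.
  by rewrite eP => /(_ i); rewrite mxE => /andP[].
have elow i : (Q.2 ord0 i)%:~R * (2 : R) ^ (- Q.1) =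
              (Q'.2 ord0 i)%:~R * 2 ^ (- Q'.1).
  by apply/eqP; rewrite eq_le !low.
have side : forall (P P' : dyadic d), cube R P = cube R P' ->
    (forall i, (P.2 ord0 i)%:~R * (2 : R) ^ (- P.1) =
               (P'.2 ord0 i)%:~R * 2 ^ (- P'.1)) ->
    (2 : R) ^ (- P.1) <= 2 ^ (- P'.1).
  move=> P P' eP eL; rewrite leNgt; apply/negP => lt21.
  have : cube R P (\row_j ((P.2 ord0 j)%:~R * 2 ^ (- P.1) + 2 ^ (- P'.1))).
    move=> j; rewrite mxE lerDl ltW ?exprz_gt0//=.
    by rewrite intrD mulrDl mul1r ltrD2l.
  rewrite eP => /(_ (Ordinal d0)); rewrite mxE => /andP[_].
  by rewrite eL intrD mulrDl mul1r ltxx.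
have eside : (2 : R) ^ (- Q.1) = 2 ^ (- Q'.1).
  by apply/eqP; rewrite eq_le !side.
have e1 : Q.1 = Q'.1.
  apply: oppr_inj; apply: (@ieexprIz R 2) eside => //.
  by rewrite (eqr_nat R 2 1).
case: Q Q' elow e1 {eQ side eside low} => [k n] [k' n'] /= elow e1.
rewrite e1 in elow *; congr (_, _); apply/rowP => i; have := elow i.
by move=> /mulIf h; apply: (@intr_inj R); apply: h; rewrite expfz_neq0.
Qed.

Section sparse.
Variables (R : realType) (d : nat).
Variable mu : {measure set (borel_rV R d) -> \bar R}.

Definition children (F : set (dyadic d)) (Q : dyadic d) : set (dyadic d) :=
  [set P | [/\ F P, cube R P `<` cube R Q &
    forall P', F P' -> cube R P' `<` cube R Q ->
      cube R P `<=` cube R P' -> cube R P = cube R P']].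

Definition sparse (F : set (dyadic d)) : Prop :=
  exists2 gamma : R, 0 < gamma < 1 &
    forall Q, F Q ->
      (\esum_(P in children F Q) mu (cube R P) <= gamma%:E * mu (cube R Q))%E.

End sparse.

Section median.
Variables (R : realType) (d : nat).
Variable mu : {measure set (borel_rV R d) -> \bar R}.
Implicit Types (f : 'rV[R]_d -> R) (Q : dyadic d).

Definition is_median f Q (m : R) : Prop :=
  (0 < mu (cube R Q))%E ->
  (mu (cube R Q `&` [set x | (m < f x)%R]) <= (2^-1 : R)%:E * mu (cube R Q))%E /\
  (mu (cube R Q `&` [set x | (f x < m)%R]) <= (2^-1 : R)%:E * mu (cube R Q))%E.

(* For [f] measurable, [mu] locally finite and [0 < lambda] the infimum is a
   minimum: the set is nonempty by continuity of [mu] from above, and closed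
   by continuity from below. *)
Definition rel_med_osc (lambda : R) f Q : R :=
  inf [set r : R | 0 <= r /\
    (mu (cube R Q `&` [set x | (r < `|f x|)%R]) <=
       lambda%:E * mu (cube R Q))%E].

Definition med_osc (lambda : R) f Q : R :=
  inf [set rel_med_osc lambda (fun x => f x - c) Q | c in [set: R]].

End median.

(* Main.v *)
Require Import Defs.
From HB Require Import structures.
From mathcomp Require Import all_boot all_order all_algebra finmap.
From mathcomp Require Import all_classical all_reals all_analysis.
From mathcomp Require Import zify lra.
Set Implicit Arguments.
Unset Strict Implicit.
Unset Printing Implicit Defensive.
Import Order.TTheory GRing.Theory Num.Theory.
Import numFieldNormedType.Exports.
Local Open Scope classical_set_scope.
Local Open Scope ring_scope.

(** The theorem is a stopping-time argument with C = 2.  Write w(T) for the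
median oscillation of f on T.  For lambda < 1/2 the fixed median m(T) is as
good a centre as any, up to a factor 2: the set E(T) of the x with
|f(x) - m(T)| > 2 w(T) fills at most the proportion lambda of T
([median_concentration]).  Fix eta strictly between lambda and 1/2.  Inside a
stopped cube T, stop at the maximal dyadic cubes Q with
mu(Q n E(T)) > eta mu(Q), restart from each of them, and begin with F0.

Sparseness.  The cubes stopped next after T are disjoint and their total
measure is at most mu(T n E(T)) / eta <= (lambda / eta) mu(T)
([measure_successors], [stopped_sparse]).

Domination.  Follow the dyadic cubes Q_0 = F0, Q_1, ... that shrink to x, and
let T_j be the last stopped cube above Q_j.  As long as the process does not
stop, mu(Q_j n E(T_j)) <= eta mu(Q_j) with eta < 1/2, so the median of Q_j
is within 2 w(T_j) of that of T_j ([median_near]).  When it stops at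
Q_(j+1), whose parent is Q_j, the jump |m(Q_(j+1)) - m(T_j)| therefore
costs at most |m(Q_(j+1)) - m(parent of Q_(j+1))| + 2 w(T_j).  The median of
the parent in the conclusion is there for this step: for a non-doubling
measure the mass of Q_(j+1) says nothing about f on its parent, whereas the
parent itself has not stopped.  Summing the jumps bounds
|m(T_n) - m(parent of F0)| + 2 w(T_n) by twice the sum over the stopped
cubes met so far ([host_at_telescope]); if moreover x is not in E(T_n), then
|f(x) - m(T_n)| <= 2 w(T_n) and the claim follows at x.

Almost every point leaves some E(T_n) ([ae_escape]).  Points that meet
infinitely many stopped cubes form a null set by the geometric decay in the
sparseness estimate ([recurrent_null]).  The other bad points have a final
stopped cube T and lie in the part A of E(T) that no later stopping covers;
there every small cube Q that meets A satisfies mu(Q n A) <= eta mu(Q).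
A set with this property is null ([null_of_small_density]): it can be
approximated in measure by unions of dyadic cubes of one generation
([approx_borel]), which turns the bound on cubes into
mu(A) <= eta mu(A). *)

(** * Dyadic cubes through the points they contain *)

Section cube_at.
Variables (R : realType) (d : nat).
Implicit Types (P Q : dyadic d) (x : 'rV[R]_d) (k : int).

Definition cube_at k x : dyadic d := (k, \row_i Num.floor (x ord0 i * 2 ^ k)).

(** Membership in a cube becomes an equation, so that nestedness, parents and
disjointness of cubes reduce to computing with generations. *)
Lemma cubeP Q x : cube R Q x <-> cube_at Q.1 x = Q.
Proof.
have e0 k : (2 : R) ^ k != 0 by rewrite expfz_neq0.
have p0 k : 0 < (2 : R) ^ k by rewrite exprz_gt0.
have itvE k (n : int) (y : R) :
    (n%:~R * 2 ^ (- k) <= y < (n + 1)%:~R * 2 ^ (- k)) =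
    (n%:~R <= y * 2 ^ k < (n + 1)%:~R).
  by rewrite -invr_expz ler_pdivrMr// ltr_pdivlMr.
split=> [Qx|].
  case: Q Qx => k n Qx; congr pair; apply/rowP => i; rewrite mxE.
  by apply: floor_def; have := Qx i; rewrite itvE.
by move=> <- i; rewrite itvE /= mxE floor_itv.
Qed.

Lemma cube_cube_at k x : cube R (cube_at k x) x.
Proof. exact/cubeP. Qed.

Lemma parent_cube_at k x : parent (cube_at k x) = cube_at (k - 1) x.
Proof.
by apply/esym/(cubeP (parent (cube_at k x)))/cube_parent; exact: cube_cube_at.
Qed.

Lemma iter_parent_cube_at j k x :
  iter j (@parent d) (cube_at k x) = cube_at (k - j%:Z) x.
Proof.
elim: j => [|j IH]; first by rewrite subr0.
by rewrite iterS IH parent_cube_at; congr cube_at; lia.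
Qed.

Lemma level_iter_parent j Q : (iter j (@parent d) Q).1 = Q.1 - j%:Z.
Proof. by elim: j => [|j IH]; rewrite ?subr0// iterS /= IH; lia. Qed.

Lemma cube_iter_parent j Q : cube R Q `<=` cube R (iter j (@parent d) Q).
Proof.
elim: j => [//|j IH]; rewrite iterS.
by apply: subset_trans IH _; exact: cube_parent.
Qed.

Lemma cube_nonempty Q : exists x, cube R Q x.
Proof.
exists (\row_i ((Q.2 ord0 i)%:~R * 2 ^ (- Q.1))) => i.
by rewrite !mxE lexx ltr_pM2r ?exprz_gt0// ltr_int ltzD1/=.
Qed.

(** Two cubes with a common point x are both of the form [cube_at k x], so
the one of coarser generation is an ancestor of the other. *)
Lemma proper_cube P Q : cube R P `<` cube R Q ->
  exists j, Q = iter j.+1 (@parent d) P.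
Proof.
move=> [PQ nQP]; have [x Px] := cube_nonempty P.
have eP := (cubeP P x).1 Px; have eQ := (cubeP Q x).1 (PQ _ Px).
have [lt|le] := ltrP Q.1 P.1.
  exists `|P.1 - Q.1|%N.-1; rewrite prednK; last first.
    by rewrite absz_gt0 subr_eq0 gt_eqF.
  rewrite -eP iter_parent_cube_at gez0_abs ?subr_ge0 ?(ltW lt)//.
  by rewrite opprB addrC subrK eQ.
exfalso; apply: nQP.
have -> : P = iter `|Q.1 - P.1|%N (@parent d) Q.
  rewrite -{2}eQ iter_parent_cube_at gez0_abs ?subr_ge0//.
  by rewrite opprB addrC subrK eP.
exact: cube_iter_parent.
Qed.

End cube_at.

Section cube_measurable.
Variables (R : realType) (d : nat).
Local Notation T := (borel_rV R d).

Lemma open_borel_measurable (U : set 'rV[R]_d) :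
  open U -> measurable (U : set T).
Proof. by move=> oU; exact: sub_sigma_algebra. Qed.

Lemma closed_borel_measurable (U : set 'rV[R]_d) :
  closed U -> measurable (U : set T).
Proof.
move=> cU; rewrite -[U]setCK; apply: measurableC.
by apply: open_borel_measurable; rewrite openC.
Qed.

Lemma measurable_cube (Q : dyadic d) : measurable (cube R Q : set T).
Proof.
pose c := (2 : R) ^ (- Q.1).
rewrite (_ : cube R Q = \bigcap_(i in [set: 'I_d])
    ([set x | (Q.2 ord0 i)%:~R * c <= x ord0 i] `&`
     [set x | x ord0 i < (Q.2 ord0 i + 1)%:~R * c])); last first.
  apply/seteqP; split=> x /= Qx i.
    by have /andP[] := Qx i.
  by have [? ?] := Qx i I; apply/andP.
rewrite -[X in measurable X]setCK setC_bigcap; apply: measurableC.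
apply: countable_bigcupT_measurable => [|i]; first exact: countableP.
have ci x : {for x, continuous (fun x : 'rV[R]_d => x ord0 i)}.
  exact: coord_continuous.
apply/measurableC/measurableI.
  apply: closed_borel_measurable.
  by apply: (closed_comp _ (@closed_ge _ _)) => x _; exact: ci.
apply: open_borel_measurable.
by apply: (open_comp _ (@open_lt _ _)) => x _; exact: ci.
Qed.

(** A condition on the generation-k cube around x selects a countable union of
cubes. *)
Lemma measurable_cube_at k (S : set (dyadic d)) :
  measurable ([set x | S (cube_at k x)] : set T).
Proof.
rewrite (_ : [set x | _] = \bigcup_Q
  (if `[<S Q /\ Q.1 = k>] then cube R Q else set0)).
  apply: countable_bigcupT_measurable => [|Q]; first exact: countableP.
  by case: ifP => _; [exact: measurable_cube|exact: measurable0].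
apply/seteqP; split=> x /=.
  move=> Sx; exists (cube_at k x) => //.
  by case: asboolP => [_|]; [exact: cube_cube_at|case].
move=> [Q _]; case: asboolP => // -[SQ <-] /cubeP Qx.
by rewrite Qx.
Qed.

End cube_measurable.

(** * Null sets from densities on dyadic cubes *)

Lemma le_measure_sub d (T : measurableType d) (R : realType)
    (mu : {measure set T -> \bar R}) (A B : set T) :
  measurable A -> measurable B -> A `<=` B -> (mu A <= mu B)%E.
Proof. by move=> mA mB AB; apply: le_measure; rewrite ?inE. Qed.

Lemma mscaleE d (T : measurableType d) (R : realType)
    (mu : {measure set T -> \bar R}) (c : R) (c0 : 0 <= c) (A : set T) :
  (mscale (NngNum c0) mu : {measure set T -> \bar R}) A = (c%:E * mu A)%E.
Proof. by []. Qed.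

Section countable_unions.
Context (d : measure_display) (T : measurableType d) (R : realType).
Variable I : countType.
Implicit Types (mu nu : {measure set T -> \bar R}) (S : set I).

Lemma measurable_countable_bigcup S (A : I -> set T) :
  (forall i, measurable (A i)) -> measurable (\bigcup_(i in S) A i).
Proof.
move=> mA; rewrite bigcup_mkcond.
apply: countable_bigcupT_measurable => [|i]; first exact: countableP.
by case: ifP.
Qed.

Lemma measure_countable_bigcup mu S (A : I -> set T) :
  (forall i, measurable (A i)) -> trivIset S A ->
  mu (\bigcup_(i in S) A i) = (\esum_(i in S) mu (A i))%E.
Proof.
move=> mA tA.
pose D := [set choice.pickle i | i in S].
pose B n := if choice.unpickle n is Some i then A i else set0.
have BE i : B (choice.pickle i) = A i by rewrite /B choice.pickleK.
rewrite (_ : \bigcup_(i in S) A i = \bigcup_(n in D) B n); last first.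
  by rewrite bigcup_image; apply: eq_bigcupr => i _; rewrite BE.
rewrite measure_bigcup; first last.
- move=> _ _ [i Si <-] [j Sj <-]; rewrite !BE => AB.
  by congr choice.pickle; exact: tA.
- by move=> _ [i Si <-]; rewrite BE.
rewrite nneseries_esum // set_mem_set esum_image; last first.
  by move=> i j _ _; exact: (pcan_inj choice.pickleK).
by apply: eq_esum => i _; rewrite BE.
Qed.

(** Used with nu a multiple of mu: a bound on each piece of a disjoint family
passes to the union. *)
Lemma le_measure_bigcup mu nu S (A B : I -> set T) :
  (forall i, measurable (A i)) -> (forall i, measurable (B i)) ->
  trivIset S A -> trivIset S B ->
  (forall i, S i -> mu (A i) <= nu (B i))%E ->
  (mu (\bigcup_(i in S) A i) <= nu (\bigcup_(i in S) B i))%E.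
Proof.
by move=> mA mB tA tB AB; rewrite !measure_countable_bigcup//; exact: le_esum.
Qed.

End countable_unions.

(** Continuity of mu from above, along the sets F minus B n, which decrease to
the empty set on the union of the B n. *)
Lemma bigcup_setD_small d (T : measurableType d) (R : realType)
    (mu : {measure set T -> \bar R}) (F : set T) (B : (set T)^nat) (e : R) :
  measurable F -> (mu F < +oo)%E -> (forall n, measurable (B n)) ->
  nondecreasing_seq B -> 0 < e ->
  exists n, (mu (F `&` (\bigcup_k B k `\` B n)) <= e%:E)%E.
Proof.
move=> mF Foo mB ndB e0.
pose G n := F `&` (\bigcup_k B k `\` B n).
have mU : measurable (\bigcup_k B k) by exact: bigcupT_measurable.
have mG n : measurable (G n) by apply: measurableI => //; exact: measurableD.
have G0 : \bigcap_n G n = set0.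
  rewrite -subset0 => x Gx; have [_ [[k _ Bk] _]] := Gx 0 I.
  by have [_ []] := Gx k I.
have cG : mu \o G @ \oo --> mu (\bigcap_n G n).
  apply: nonincreasing_cvg_mu => //.
  - by apply: le_lt_trans Foo; apply: le_measure_sub => //; exact: subIsetl.
  - by rewrite G0.
  - move=> m n mn; apply/subsetPset => x [Fx [Ux nB]]; split=> //; split=> // Bx.
    by apply: nB; move/subsetPset : (ndB _ _ mn); exact.
rewrite G0 measure0 in cG.
have /cG[n _ /(_ n (leqnn _)) Gn] : nbhs (0 : \bar R) [set y | (y < e%:E)%E].
  exact: (@nbhs_open_ereal_lt _ 0 (fun=> e)).
by exists n; exact: ltW.
Qed.

Section approximation.
Variables (R : realType) (d : nat) (mu : {measure set (borel_rV R d) -> \bar R}).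
Variables (F : set (borel_rV R d)) (k0 : int).
Hypotheses (mF : measurable F) (Foo : (mu F < +oo)%E).
Local Notation T := (borel_rV R d).
Implicit Types (A B : set T) (S : set (dyadic d)).

(** A union of cubes of the single generation k.  Fixing the generation makes
these sets closed under complement, with no bookkeeping of maximal cubes. *)
Definition gridset k S : set T := [set x | S (cube_at k x)].

Definition approx A := forall e : R, 0 < e ->
  exists k S, k0 <= k /\ (mu (F `&` (A `+` gridset k S)) <= e%:E)%E.

Lemma measurable_setY A B : measurable A -> measurable B -> measurable (A `+` B).
Proof. by move=> mA mB; rewrite /setY; apply: measurableU; exact: measurableD. Qed.

(** Two grid sets can thus be brought to a common generation. *)
Lemma gridset_refine k k' S : k <= k' -> exists S', gridset k S = gridset k' S'.
Proof.
move=> kk'; exists [set Q | S (iter `|k' - k|%N (@parent d) Q)].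
apply/seteqP; split=> x; rewrite /gridset /= iter_parent_cube_at;
  by have -> : k' - `|k' - k|%N%:Z = k by lia.
Qed.

Let small A B C (e1 e2 : R) : measurable A -> measurable B -> measurable C ->
  A `<=` B `|` C -> (mu (F `&` B) <= e1%:E)%E -> (mu (F `&` C) <= e2%:E)%E ->
  (mu (F `&` A) <= (e1 + e2)%:E)%E.
Proof.
move=> mA mB mC ABC Be Ce; rewrite EFinD; apply: le_trans (leeD Be Ce).
apply: le_trans (measureU2 _ _ _); try exact: measurableI.
apply: le_measure_sub; rewrite -?setIUr.
- exact: measurableI.
- by apply: measurableI => //; exact: measurableU.
- exact: setIS.
Qed.

Lemma approx_gridset k S : approx (gridset k S).
Proof.
move=> e e0; have kk : k <= Num.max k k0 by rewrite le_max lexx.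
have [S' ->] := gridset_refine S kk.
exists (Num.max k k0), S'; split; first by rewrite le_max lexx orbT.
by rewrite setYK setI0 measure0 lee_fin ltW.
Qed.

Lemma approxC A : approx A -> approx (~` A).
Proof.
move=> aA e /aA[k [S [kk0 AS]]]; exists k, (~` S); split=> //.
rewrite (_ : _ `+` _ = A `+` gridset k S)//.
by apply/seteqP; split=> x; rewrite /setY /gridset /=;
  have := (EM (A x), EM (S (cube_at k x))); tauto.
Qed.

Lemma approxU A B : measurable A -> measurable B ->
  approx A -> approx B -> approx (A `|` B).
Proof.
move=> mA mB aA aB e e0.
have e20 : 0 < e / 2 by rewrite divr_gt0.
have [k [S [kk0 AS]]] := aA _ e20.
have [l [U [lk0 BU]]] := aB _ e20.
have kkl : k <= Num.max k l by rewrite le_max lexx.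
have lkl : l <= Num.max k l by rewrite le_max lexx orbT.
have [[S' eS] [U' eU]] := (gridset_refine S kkl, gridset_refine U lkl).
exists (Num.max k l), (S' `|` U'); split; first by rewrite le_max kk0.
rewrite [e]splitr.
have mg j V : measurable (gridset j V) by exact: measurable_cube_at.
apply: small AS BU; try exact: measurable_setY.
  by apply: measurable_setY => //; exact: measurableU.
rewrite eS eU => x; rewrite /setY /gridset /=; tauto.
Qed.

(** Finitely many of the sets already exhaust the union up to measure e / 2, and
finite unions are handled by a common refinement of the grids. *)
Lemma approx_bigcup (A : (set T)^nat) : (forall n, measurable (A n)) ->
  (forall n, approx (A n)) -> approx (\bigcup_n A n).
Proof.
move=> mA aA e e0.
have e20 : 0 < e / 2 by rewrite divr_gt0.
pose B n := \big[setU/set0]_(i < n.+1) A i.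
have mB n : measurable (B n) by exact: bigsetU_measurable.
have aB n : approx (B n).
  elim: n => [|n IH]; rewrite /B big_ord_recr /=; first by rewrite big_ord0 set0U.
  by apply: approxU => //; exact: mB.
have UB : \bigcup_n A n = \bigcup_n B n by rewrite -[LHS]bigcup_bigsetU_bigcup.
have ndB : nondecreasing_seq B.
  by move=> m n mn; apply/subsetPset; exact: subset_bigsetU.
have [n Bn] := bigcup_setD_small mF Foo mB ndB e20.
have [k [S [kk0 BS]]] := aB n _ e20.
exists k, S; split=> //; rewrite [e]splitr UB.
have mU : measurable (\bigcup_n B n) by exact: bigcupT_measurable.
have mg j V : measurable (gridset j V) by exact: measurable_cube_at.
apply: small Bn BS; try exact: measurable_setY; first exact: measurableD.
have BU : B n `<=` \bigcup_n B n by move=> x; exists n.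
move=> x; rewrite /setY /setD /setU /=; have := (BU x, EM (B n x)); tauto.
Qed.

(** An open set is the union over n of the grid sets of its cubes of
generation n. *)
Lemma approx_open (U : set 'rV[R]_d) : open U -> approx U.
Proof.
move=> oU; rewrite (_ : U =
    \bigcup_(n in [set: nat]) gridset n%:Z [set Q | cube R Q `<=` U]).
  apply: approx_bigcup => n; [exact: measurable_cube_at|exact: approx_gridset].
apply/seteqP; split=> [x Ux|x [n _]]; last by apply; exact: cube_cube_at.
have /nbhs_ballP[e /= e0 xeU] : nbhs x U by exact: open_nbhs_nbhs.
(* Side length 2^-n < e keeps the cube around x within the sup-norm e-ball. *)
exists (Num.bound e^-1) => // y /cubeP /= yx; apply: xeU; split=> // i j.
rewrite [i]ord1.
set n := Num.bound e^-1 in yx *.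
have c0 : 0 < (2 : R) ^ (- n%:Z) by rewrite exprz_gt0.
have ne : (2 : R) ^ (- n%:Z) < e.
  rewrite -invr_expz -[ltRHS]invrK ltf_pV2 ?posrE ?invr_gt0//.
  exact: upper_nthrootP.
have /(_ j)/andP[+ +] := cube_cube_at n%:Z x.
have /(_ j)/andP[+ +] := cube_cube_at n%:Z y.
rewrite yx /= mxE intrD mulrDl mul1r.
set a := _ * _ => *.
by rewrite /ball /= ltr_norml; apply/andP; split; lra.
Qed.

(** The approximable measurable sets form a sigma-algebra containing the open
sets. *)
Lemma approx_borel A : measurable A -> approx A.
Proof.
move=> mA; suff [] : [set A | measurable A /\ approx A] A by [].
apply: (smallest_sub _ _ mA); last first.
  by move=> U oU; split; [exact: open_borel_measurable|exact: approx_open].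
split=> /=.
- by split=> //; exact: (approx_gridset 0 set0).
- by move=> B [mB aB]; rewrite setTD; split; [exact: measurableC|exact: approxC].
- move=> B mB; split; first by apply: bigcupT_measurable => n; have [] := mB n.
  by apply: approx_bigcup => n; have [] := mB n.
Qed.

End approximation.

(** A substitute for Lebesgue differentiation along dyadic cubes.  The
density bound is additive over the cubes of a grid set W, and W can be chosen
close to A; then mu(A) is almost mu(A n W) <= eta mu(W n F), which is almost
at most eta mu(A). *)
Lemma null_of_small_density (R : realType) (d : nat)
    (mu : {measure set (borel_rV R d) -> \bar R})
    (F A : set (borel_rV R d)) (k0 : int) (eta : R) :
  measurable F -> (mu F < +oo)%E -> measurable A -> A `<=` F ->
  0 <= eta < 1 ->
  (forall Q : dyadic d, k0 <= Q.1 ->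
    (mu (cube R Q `&` A) <= eta%:E * mu (cube R Q `&` F))%E) ->
  mu A = 0%E.
Proof.
move=> mF Foo mA AF /andP[eta0 eta1] Aeta.
have Aoo : (mu A < +oo)%E by apply: le_lt_trans Foo; exact: le_measure_sub.
have fin B : measurable B -> B `<=` F -> mu B \is a fin_num.
  move=> mB BF; rewrite ge0_fin_numE//; apply: le_lt_trans Foo.
  exact: le_measure_sub.
have grid k S : k0 <= k ->
    (mu (gridset k S `&` A) <= eta%:E * mu (gridset k S `&` F))%E.
  move=> kk0.
  have gE B : gridset k S `&` B =
      \bigcup_(Q in [set Q | S Q /\ Q.1 = k]) (cube R Q `&` B).
    apply/seteqP; split=> x; rewrite /gridset /=.
      by move=> [Sx Bx]; exists (cube_at k x) => //; split=> //; exact: cube_cube_at.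
    by move=> [Q [SQ <-] [/cubeP Qx Bx]]; rewrite Qx.
  have tI B : trivIset [set Q | S Q /\ Q.1 = k] (fun Q => cube R Q `&` B).
    move=> P Q [_ Pk] [_ Qk] [x [[/cubeP Px _] [/cubeP Qx _]]].
    by rewrite -Px -Qx Pk Qk.
  rewrite !gE -(mscaleE mu eta0).
  apply: le_measure_bigcup => //.
  - by move=> Q; apply: measurableI => //; exact: measurable_cube.
  - by move=> Q; apply: measurableI => //; exact: measurable_cube.
  - by move=> Q [SQ Qk]; apply: Aeta; rewrite Qk.
have main e : 0 < e -> (mu A <= eta%:E * mu A + (2 * e)%:E)%E.
  move=> e0; have [k [S [kk0 AS]]] := @approx_borel _ _ mu F k0 mF Foo A mA e e0.
  set W := gridset k S in AS.
  have mW : measurable W by exact: measurable_cube_at.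
  have small B : measurable B -> B `<=` F `&` (A `+` W) -> (mu B <= e%:E)%E.
    move=> mB BAW; apply: le_trans AS; apply: le_measure_sub => //.
    by apply: measurableI => //; exact: measurable_setY.
  have AW : (mu (A `\` W) <= e%:E)%E.
    apply: small; first exact: measurableD.
    by rewrite /setY => x [Ax nWx]; split; [exact: AF|left].
  have WA : (mu ((W `&` F) `\` A) <= e%:E)%E.
    apply: small; first by apply: measurableD => //; exact: measurableI.
    by rewrite /setY => x [[Wx Fx] nAx]; split=> //; right.
  have WF : (mu (W `&` F) <= mu A + e%:E)%E.
    rewrite (measureDI mu (measurableI _ _ mW mF) mA) addeC; apply: leeD => //.
    apply: (@le_measure_sub _ _ _ mu _ _ _ _ (@subIsetr _ _ _)) => //.
    by apply: measurableI => //; exact: measurableI.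
  have WAeta : (mu (A `&` W) <= eta%:E * (mu A + e%:E))%E.
    rewrite setIC; apply: le_trans (grid k S kk0) _.
    by apply: lee_wpmul2l => //; rewrite lee_fin.
  rewrite [leLHS](measureDI mu mA mW); apply: le_trans (leeD AW WAeta) _.
  rewrite -(fineK (fin _ mA AF)) -!(EFinD, EFinM) lee_fin.
  suff : eta * e <= e by lra.
  by rewrite ger_pMl// ltW.
apply/eqP; rewrite -measure_le0.
have finA := fin _ mA AF.
rewrite -[leLHS](fineK finA) lee_fin leNgt; apply/negP => a0.
set a := fine (mu A) in a0.
(* The gap (1 - eta) a exceeds the error 2 e for this e. *)
have e0 : 0 < (1 - eta) * a / 4 by rewrite divr_gt0// mulr_gt0// subr_gt0.
have := main _ e0; rewrite -(fineK finA) -/a -!(EFinD, EFinM) lee_fin; nra.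
Qed.

(** * The stopping cubes *)

Section stopping.
Variables (R : realType) (d : nat) (mu : {measure set (borel_rV R d) -> \bar R}).
Variables (F0 : dyadic d) (E : dyadic d -> set (borel_rV R d)) (eta : R).
Implicit Types (P Q T : dyadic d) (x : 'rV[R]_d) (i j n : nat).

Definition fires T Q := (eta%:E * mu (cube R Q) < mu (cube R Q `&` E T))%E.

(** For Q of generation j below F0, the smallest stopped cube that contains Q,
computed down the branch from F0 to Q.  A recursion along ancestors gives the
maximal stopping cubes without any choice of maximal elements. *)
Fixpoint host j Q : dyadic d :=
  if j is j'.+1 then
    let T := host j' (parent Q) in if fires T Q then Q else T
  else Q.

Definition stopped : set (dyadic d) :=
  [set Q | exists j, iter j (@parent d) Q = F0 /\ host j Q = Q].

(** The cubes at which the process restarts after T: the maximal cubes inside T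
that fire. *)
Definition successors T : set (dyadic d) :=
  [set P | exists j,
     [/\ iter j.+1 (@parent d) P = F0, host j (parent P) = T & fires T P]].

Definition branch j x : dyadic d := cube_at (F0.1 + j%:Z) x.
Definition host_at j x : dyadic d := host j (branch j x).

Lemma branch_inj x i j : branch i x = branch j x -> i = j.
Proof. by move=> /(congr1 fst) /=; lia. Qed.

Lemma branch_parent j x : parent (branch j.+1 x) = branch j x.
Proof. by rewrite parent_cube_at; congr cube_at; lia. Qed.

Lemma branch_iter i j x : iter i (@parent d) (branch (i + j) x) = branch j x.
Proof. by rewrite iter_parent_cube_at; congr cube_at; lia. Qed.

Lemma cube_branch j x : cube R (branch j x) x.
Proof. exact: cube_cube_at. Qed.

Lemma branch0 x : cube R F0 x -> branch 0 x = F0.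
Proof. by rewrite /branch addr0 => /cubeP. Qed.

Lemma iter_parent_branch j x : cube R F0 x ->
  iter j (@parent d) (branch j x) = F0.
Proof.
move=> F0x; rewrite -[RHS](branch0 F0x) /branch iter_parent_cube_at.
by congr cube_at; lia.
Qed.

Lemma le_branch i j x : (i <= j)%N ->
  cube R (branch j x) `<=` cube R (branch i x).
Proof.
by move=> /subnK <-; rewrite -(branch_iter (j - i) i); exact: cube_iter_parent.
Qed.

Lemma branch_sub j x : cube R F0 x -> cube R (branch j x) `<=` cube R F0.
Proof. by move=> /branch0 bF0; rewrite -[in X in _ `<=` X]bF0; exact: le_branch. Qed.

Lemma descendant_branch j Q x : iter j (@parent d) Q = F0 -> cube R Q x ->
  cube R F0 x /\ Q = branch j x.
Proof.
move=> QF0 Qx; split; first by rewrite -QF0; exact: cube_iter_parent.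
rewrite -{1}((cubeP Q x).1 Qx) /branch -QF0 level_iter_parent.
by congr cube_at; lia.
Qed.

Lemma host_atS j x : host_at j.+1 x =
  if fires (host_at j x) (branch j.+1 x) then branch j.+1 x else host_at j x.
Proof. by rewrite /host_at /= branch_parent. Qed.

Lemma stoppedP Q x : cube R Q x ->
  stopped Q <-> exists j, [/\ cube R F0 x, Q = branch j x & host_at j x = Q].
Proof.
move=> Qx; split=> -[j].
  move=> [/descendant_branch/(_ Qx)[F0x QE] tQ].
  by exists j; split=> //; rewrite /host_at -QE.
move=> [F0x -> tQ]; exists j; split=> //.
exact: iter_parent_branch.
Qed.

Lemma successorsP T P x : cube R P x -> successors T P <-> exists j,
  [/\ cube R F0 x, P = branch j.+1 x, host_at j x = T & fires T P].
Proof.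
move=> Px; split=> -[j].
  move=> [/descendant_branch/(_ Px)[F0x PE] tP fP].
  by exists j; split=> //; rewrite /host_at -branch_parent -PE.
move=> [F0x PE tP fP]; exists j; split=> //.
  by rewrite PE; exact: iter_parent_branch.
by rewrite PE branch_parent.
Qed.

(** The host along a branch is the cube of the last stop, and it stays constant
since then. *)
Lemma host_at_branch j x : exists i,
  [/\ (i <= j)%N, host_at i x = branch i x &
      forall l, (i <= l <= j)%N -> host_at l x = branch i x].
Proof.
elim: j => [|j [i [ij ti il]]].
  by exists 0; split=> // l; rewrite -eqn_leq => /eqP <-.
have := host_atS j x; case: ifP => _ tj.
  by exists j.+1; split=> // l; rewrite -eqn_leq => /eqP <-.
exists i; split=> //; first by rewrite leqW.
move=> l /andP[il']; rewrite leq_eqVlt => /predU1P[->|lj].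
  by rewrite tj il// ij leqnn.
by rewrite il// il'.
Qed.

Lemma host_at_last i j x : host_at i x = branch i x -> (i <= j)%N ->
  exists l,
    [/\ (i <= l <= j)%N, host_at l x = branch l x & host_at j x = branch l x].
Proof.
move=> ti ij; have [l [lj tl H]] := host_at_branch j x.
have [il|li] := leqP i l.
  by exists l; split=> //; [rewrite il|apply: H; rewrite lj leqnn].
have := H i; rewrite ti ij (ltnW li) => /(_ isT)/branch_inj.
by lia.
Qed.

(** The host of generation j is a cube of generation at most j, so it can only
become [branch j.+1 x] by firing. *)
Lemma stop_fires j x : host_at j.+1 x = branch j.+1 x ->
  fires (host_at j x) (branch j.+1 x).
Proof.
rewrite host_atS; case: ifP => // _ tj.
have [i [ij _ /(_ j)]] := host_at_branch j x.
by rewrite ij leqnn tj => /(_ isT)/branch_inj ji; rewrite -ji ltnn in ij.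
Qed.

Lemma host_at_sub j x : cube R (branch j x) `<=` cube R (host_at j x).
Proof.
have [i [ij _ /(_ j)]] := host_at_branch j x.
by rewrite ij leqnn => -> //; exact: le_branch.
Qed.

Lemma stopped_sub Q : stopped Q -> cube R Q `<=` cube R F0.
Proof. by move=> [j [<- _]]; exact: cube_iter_parent. Qed.

Lemma successors_sub T P : successors T P -> cube R P `<=` cube R T.
Proof.
move=> TP x Px; have [j [F0x PE <- _]] := (successorsP _ Px).1 TP.
by apply: host_at_sub; exact: cube_branch.
Qed.

Lemma successors_stopped T P : successors T P -> stopped P.
Proof.
move=> TP; have [x Px] := cube_nonempty R P.
have [j [F0x PE tj fP]] := (successorsP _ Px).1 TP.
apply/(stoppedP Px); exists j.+1; split=> //.
by rewrite host_atS tj -PE fP.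
Qed.

(** If one of two such cubes around x came later on the branch, the host just
before it would already be the earlier cube, or one below it, and not T. *)
Lemma successors_trivIset T : trivIset (successors T) (fun P => cube R P).
Proof.
suff H x j j' : host_at j x = T -> fires T (branch j.+1 x) -> host_at j' x = T ->
    (j < j')%N -> False.
  move=> P P' TP TP' [x [Px P'x]].
  have [j [F0x PE tj fP]] := (successorsP _ Px).1 TP.
  have [j' [_ P'E tj' fP']] := (successorsP _ P'x).1 TP'.
  have [jj'|j'j|jE] := ltngtP j j'; last by rewrite PE P'E jE.
  - by case: (H x j j'); rewrite // -PE.
  - by case: (H x j' j); rewrite // -P'E.
move=> tj fj tj' jj'.
have sj : host_at j.+1 x = branch j.+1 x by rewrite host_atS tj fj.
have [l [/andP[jl _] _]] := host_at_last sj jj'.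
rewrite tj' -tj; have [i [ij _ /(_ j)]] := host_at_branch j x.
by rewrite ij leqnn => /(_ isT) -> /branch_inj il; lia.
Qed.

(** The combinatorial children are the restart cubes: if P is a stopped proper
subcube of Q, the host just above P lies between P and Q, and maximality of P
forces it to be Q. *)
Lemma children_successors Q : (0 < d)%N -> stopped Q ->
  children R stopped Q `<=` successors Q.
Proof.
move=> d0 sQ P [sP PQ Pmax]; have [x Px] := cube_nonempty R P.
have Qx : cube R Q x by case: PQ => + _; exact.
have [j [F0x PE tj]] := (stoppedP Px).1 sP.
have [i [_ QE ti]] := (stoppedP Qx).1 sQ.
have ij : (i < j)%N.
  have [k] := proper_cube PQ => /(congr1 fst).
  by rewrite level_iter_parent PE QE /=; lia.
(* Now P = branch j.+1 x, and the host of generation j is the one just above. *)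
case: j PE tj ij => // j PE tj ij; rewrite ltnS in ij.
have fP : fires (host_at j x) P by rewrite PE; apply: stop_fires; rewrite tj.
apply: (successorsP Q Px).2; exists j.
suff tjQ : host_at j x = Q by split=> //; rewrite -tjQ.
have [l [/andP[il lj] tl ->]] := host_at_last (etrans ti QE) ij.
move: il; rewrite leq_eqVlt => /predU1P[<- //|il]; exfalso.
have eP : cube R P = cube R (branch l x).
  apply: Pmax.
  - by apply/(stoppedP (cube_branch l x)); exists l.
  - split; first by rewrite QE; apply: le_branch; exact: ltnW.
    rewrite QE => le; have : branch l x = branch i x.
      apply: (cube_inj (R := R) d0); apply/seteqP; split=> //.
      by apply: le_branch; exact: ltnW.
    by move=> /branch_inj; lia.
  - by rewrite PE; apply: le_branch; rewrite leqW.
by have := cube_inj d0 eP; rewrite PE => /branch_inj; lia.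
Qed.

Variable lambda : R.
Hypotheses (mE : forall Q, measurable (E Q)) (lambda0 : 0 < lambda)
  (lambda_eta : lambda < eta) (eta1 : eta < 1) (F0oo : (mu (cube R F0) < +oo)%E).
Hypothesis (E_small : forall Q, cube R Q `<=` cube R F0 ->
  (mu (cube R Q `&` E Q) <= lambda%:E * mu (cube R Q))%E).

(** Either Q is its own host, and the initial bound lambda applies, or Q did not
fire. *)
Lemma host_at_density j x : cube R F0 x ->
  (mu (cube R (branch j x) `&` E (host_at j x)) <=
   eta%:E * mu (cube R (branch j x)))%E.
Proof.
move=> F0x.
have small : (mu (cube R (branch j x) `&` E (branch j x)) <=
    eta%:E * mu (cube R (branch j x)))%E.
  apply: le_trans (E_small (branch_sub F0x (j := j))) _.
  by apply: lee_wpmul2r => //; rewrite lee_fin ltW.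
case: j small => [|j] small; first by rewrite /host_at.
by rewrite host_atS; case: ifPn => //; rewrite -leNgt.
Qed.

Let eta0 : 0 < eta. Proof. exact: lt_trans lambda_eta. Qed.
Let etaV0 : 0 <= eta^-1. Proof. by rewrite invr_ge0 ltW. Qed.
Let gamma0 : 0 < lambda / eta. Proof. exact: divr_gt0. Qed.
Let gamma1 : lambda / eta < 1. Proof. by rewrite ltr_pdivrMr// mul1r. Qed.

(** Each restart cube P has mu(P) < mu(P n E(T)) / eta, and the sets P n E(T) are
disjoint parts of T n E(T). *)
Lemma measure_successors T : cube R T `<=` cube R F0 ->
  (mu (\bigcup_(P in successors T) cube R P) <=
   (lambda / eta)%:E * mu (cube R T))%E.
Proof.
move=> TF0.
have mcE P : measurable (cube R P `&` E T : set (borel_rV R d)).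
  by apply: measurableI => //; exact: measurable_cube.
have tr : trivIset (successors T) (fun P => cube R P `&` E T).
  move=> P P' TP TP' [x [[Px _] [P'x _]]].
  by apply: (successors_trivIset TP TP'); exists x.
apply: (@le_trans _ _ (mscale (NngNum etaV0) mu
    (\bigcup_(P in successors T) (cube R P `&` E T)))).
  apply: le_measure_bigcup => //.
  - by move=> P; exact: measurable_cube.
  - exact: successors_trivIset.
  - move=> P [j [_ _ /ltW]]; rewrite mscaleE => fP.
    by rewrite muleC lee_pdivlMr// muleC.
rewrite mscaleE mulrC EFinM -muleA lee_wpmul2l ?lee_fin//.
apply: le_trans (E_small TF0); apply: le_measure_sub => //.
  exact: measurable_countable_bigcup.
by move=> x [P TP [Px Ex]]; split=> //; exact: successors_sub TP _ Px.
Qed.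

Lemma stopped_sparse : (0 < d)%N -> sparse mu stopped.
Proof.
move=> d0; exists (lambda / eta); first by rewrite gamma0.
move=> Q sQ; apply: le_trans (measure_successors (stopped_sub sQ)).
have mU (S : set (dyadic d)) :
    measurable (\bigcup_(P in S) cube R P : set (borel_rV R d)).
  by apply: measurable_countable_bigcup => P; exact: measurable_cube.
rewrite -(measure_countable_bigcup mu (A := fun P => cube R P)).
- apply: le_measure_sub => //; apply: bigcup_subset.
  exact: children_successors.
- by move=> P; exact: measurable_cube.
- by apply: sub_trivIset (@successors_trivIset Q); exact: children_successors.
Qed.

Definition recurrent : set (borel_rV R d) :=
  cube R F0 `&` [set x | forall n, exists2 j, (n <= j)%N & host_at j x = branch j x].

Lemma recurrent_measurable : measurable recurrent.
Proof.
rewrite (_ : recurrent = cube R F0 `&` \bigcap_n \bigcup_(j in [set j | (n <= j)%N])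
    [set x | [set Q | host j Q = Q] (cube_at (F0.1 + j%:Z) x)]).
  apply: measurableI; first exact: measurable_cube.
  apply: bigcapT_measurable => n; apply: bigcup_measurable => j _.
  exact: measurable_cube_at.
apply/seteqP; split=> x [F0x xN]; split=> //.
  by move=> n _; have [j nj tj] := xN n; exists j.
by move=> n; have [j nj tj] := xN n I; exists j.
Qed.

Lemma recurrent_successors T : stopped T ->
  recurrent `&` cube R T `<=` \bigcup_(P in successors T) (recurrent `&` cube R P).
Proof.
move=> sT x [[F0x xN] Tx]; have [i [_ TE ti]] := (stoppedP Tx).1 sT.
have : exists j, (i < j)%N && (host_at j x == branch j x).
  by have [j ij tj] := xN i.+1; exists j; rewrite ij tj eqxx.
(* The first stop after T: up to it the host remains T. *)
move=> /ex_minnP[[//|j] /andP[ij /eqP tj] jmin].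
have fP := stop_fires tj.
exists (branch j.+1 x); last by split; [split|exact: cube_branch].
apply: (successorsP T (cube_branch j.+1 x)).2; exists j.
suff tjT : host_at j x = T by split=> //; rewrite -tjT.
have [l [/andP[il lj] tl ->]] := host_at_last (etrans ti TE) ij.
move: il; rewrite leq_eqVlt => /predU1P[<- //|il].
by have := jmin l; rewrite il tl eqxx => /(_ isT); rewrite leqNgt ltnS lj.
Qed.

(** Every point of a stopped cube T that is recurrent is a recurrent point of a
successor of T; iterating [measure_successors] n times bounds the measure of
these points by (lambda / eta)^n mu(T). *)
Lemma recurrent_null : mu recurrent = 0%E.
Proof.
have mN := recurrent_measurable.
have mNc T : measurable (recurrent `&` cube R T : set (borel_rV R d)).
  by apply: measurableI => //; exact: measurable_cube.
have decay n T : stopped T ->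
    (mu (recurrent `&` cube R T) <= ((lambda / eta) ^+ n)%:E * mu (cube R T))%E.
  elim: n T => [|n IH] T sT.
    by rewrite expr0 mul1e; apply: le_measure_sub => //; exact: measurable_cube.
  have mU : measurable (\bigcup_(P in successors T)
      (recurrent `&` cube R P) : set (borel_rV R d)).
    exact: measurable_countable_bigcup.
  apply: le_trans (le_measure_sub mu _ mU (recurrent_successors sT)) _ => //.
  have gn : 0 <= (lambda / eta) ^+ n by rewrite exprn_ge0 ?ltW.
  apply: (@le_trans _ _ (mscale (NngNum gn) mu
      (\bigcup_(P in successors T) cube R P))).
    apply: le_measure_bigcup => //.
    - by move=> P; exact: measurable_cube.
    - move=> P P' TP TP' [x [[_ Px] [_ P'x]]].
      by apply: (successors_trivIset TP TP'); exists x.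
    - exact: successors_trivIset.
    - by move=> P TP; rewrite mscaleE; apply: IH; exact: successors_stopped TP.
  rewrite mscaleE exprSr EFinM -muleA lee_wpmul2l ?lee_fin//.
  by apply: measure_successors; exact: stopped_sub.
have sF0 : stopped F0 by exists 0.
have NF0 : recurrent `&` cube R F0 = recurrent by apply/setIidl => x [].
have fin : mu (cube R F0) \is a fin_num by rewrite ge0_fin_numE.
apply/eqP; rewrite -measure_le0.
have finN : mu recurrent \is a fin_num.
  rewrite ge0_fin_numE//; apply: le_lt_trans F0oo; apply: le_measure_sub => //.
    exact: measurable_cube.
  by move=> x [].
rewrite -[leLHS](fineK finN) lee_fin.
have cvg0 : (lambda / eta) ^+ n * fine (mu (cube R F0)) @[n --> \oo] --> (0 : R).
  rewrite -[0](mul0r (fine (mu (cube R F0)))); apply: cvgMl.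
  by apply: cvg_expr; rewrite ger0_norm// ltW.
rewrite -(cvg_lim _ cvg0)//; apply: limr_ge; first by apply/cvg_ex; exists 0.
apply: nearW => n; rewrite -lee_fin EFinM (fineK finN) fineK//.
by have := decay n F0 sF0; rewrite NF0.
Qed.

(** The bad points of T that no later stop covers: T remains their host. *)
Definition settled T : set (borel_rV R d) :=
  cube R T `&` E T `&` [set x | forall j, T.1 <= F0.1 + j%:Z -> host_at j x = T].

Lemma settled_measurable T : measurable (settled T).
Proof.
rewrite (_ : settled T = cube R T `&` E T `&`
    \bigcap_(j in [set: nat]) [set x |
      [set Q | T.1 <= F0.1 + j%:Z -> host j Q = T] (cube_at (F0.1 + j%:Z) x)]).
  apply: measurableI; first by apply: measurableI => //; exact: measurable_cube.
  by apply: bigcapT_measurable => n; exact: measurable_cube_at.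
apply/seteqP; split=> x [Tx xN]; split=> //.
  by move=> n _; exact: xN.
by move=> n; exact: (xN n I).
Qed.

(** A cube Q below T that contains a settled point has host T, so it did not
fire: this is the density bound required for a null set. *)
Lemma settled_null T : stopped T -> mu (settled T) = 0%E.
Proof.
move=> sT; have TF0 := stopped_sub sT.
have mT := @measurable_cube R d T; have mA := settled_measurable T.
apply: (@null_of_small_density _ _ mu (cube R T) _ T.1 eta) => //.
- by apply: le_lt_trans F0oo; apply: le_measure_sub => //; exact: measurable_cube.
- by move=> x [[]].
- by rewrite eta1 ltW.
move=> Q TQ; have mQ := @measurable_cube R d Q.
have [->|/set0P[x [Qx [[Tx Ex] xT]]]] := eqVneq (cube R Q `&` settled T) set0.
  by rewrite measure0 mule_ge0// lee_fin ltW.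
have [i [F0x TE ti]] := (stoppedP Tx).1 sT.
pose j := `|Q.1 - F0.1|%N.
have TF : T.1 = F0.1 + i%:Z by rewrite TE.
have Qj : Q.1 = F0.1 + j%:Z by rewrite /j; lia.
have QE : Q = branch j x by rewrite -((cubeP Q x).1 Qx) Qj.
have tj : host_at j x = T by apply: xT; rewrite -Qj.
have QT : cube R Q `&` cube R T = cube R Q.
  by apply/setIidl; rewrite QE TE; apply: le_branch; lia.
rewrite QT; apply: le_trans (_ : mu (cube R Q `&` E T) <= _)%E.
  apply: le_measure_sub; try exact: measurableI.
  by move=> y [Qy [[_ Ey] _]].
by rewrite -tj QE; exact: host_at_density.
Qed.

(** A point of every E(T_n) either stops infinitely often or is settled in its
last stopped cube; there are countably many cubes to settle in. *)
Lemma ae_escape : {ae mu, forall x : borel_rV R d,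
  cube R F0 x -> exists n, ~ E (host_at n x) x}.
Proof.
pose B n := if (choice.unpickle n : option (dyadic d)) is Some T then
  if `[< stopped T >] then settled T else set0 else set0.
apply: (@negligibleS _ _ _ _ (recurrent `|` \bigcup_n B n)); last first.
  apply: negligibleU.
    by apply/negligibleP; [exact: recurrent_measurable|exact: recurrent_null].
  apply: negligible_bigcup => n; rewrite /B.
  case: choice.unpickle => [T|]; last exact: negligible_set0.
  case: asboolP => [sT|_]; last exact: negligible_set0.
  by apply/negligibleP; [exact: settled_measurable|exact: settled_null].
move=> x /= /not_implyP[F0x /forallNP xE].
have {}xE n : E (host_at n x) x by apply: contrapT; exact: xE.
have [N|nN] := EM (recurrent x); first by left.
right; have [n nn] : exists n, forall j, (n <= j)%N -> host_at j x <> branch j x.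
  apply: contrapT => /forallNP h; apply: nN; split=> // n.
  by have /existsNP[j /not_implyP[nj /contrapT tj]] := h n; exists j.
have [i [lin ti H]] := host_at_branch n x.
exists (choice.pickle (branch i x)) => //; rewrite /B choice.pickleK.
have si : stopped (branch i x) by apply/(stoppedP (cube_branch i x)); exists i.
case: asboolP => // _; split.
  by split; [exact: cube_branch|rewrite -ti].
move=> j /= ij; have {}ij : (i <= j)%N by lia.
have [jn|nj] := leqP j n; first by rewrite H// ij.
have [l [/andP[il lj] tl ->]] := host_at_last ti ij.
have [nl|ln] := leqP n l; first by case: (nn _ nl).
by rewrite -tl H// il ltnW.
Qed.

End stopping.

(** * Medians and median oscillation *)

(** A cube lies in a compact box, covered by finitely many open sets of finite
measure. *)
Lemma cube_finite (R : realType) (d : nat)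
    (mu : {measure set (borel_rV R d) -> \bar R}) (Q : dyadic d) :
  locally_finite_measure mu -> (mu (cube R Q) < +oo)%E.
Proof.
move=> lf.
pose a i : R := (Q.2 ord0 i)%:~R * 2 ^ (- Q.1).
pose b i : R := (Q.2 ord0 i + 1)%:~R * 2 ^ (- Q.1).
pose K : set 'rV[R]_d := [set v | forall i, `[a i, b i]%classic (v ord0 i)].
have cK : compact K.
  apply: (@rV_compact _ d (fun i => `[a i, b i]%classic)) => i.
  exact: segment_compact.
have QK : cube R Q `<=` K.
  by move=> x Qx i; have /andP[xa /ltW xb] := Qx i; rewrite /= in_itv /= xa.
pose U (x : 'rV[R]_d) := projT1 (cid2 (lf x)).
have oU x : open_nbhs x (U x) by rewrite /U; case: cid2.
have fU x : (mu (U x) < +oo)%E by rewrite /U; case: cid2.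
rewrite compact_cover in cK.
have [|x Kx|D _ KD] := cK _ setT U; first by move=> x _; case: (oU x).
  by exists x => //; case: (oU x).
have mU x : measurable (U x : set (borel_rV R d)).
  by apply: open_borel_measurable; case: (oU x).
apply: (@le_lt_trans _ _ (\sum_(x \in [set` D]) mu (U x))%E).
  apply: content_sub_fsum => //; first exact: measurable_cube.
  exact: subset_trans QK KD.
by rewrite fsbig_finite//; apply: lte_sum_pinfty.
Qed.

Section median_oscillation.
Variables (R : realType) (d : nat) (mu : {measure set (borel_rV R d) -> \bar R}).
Variables (f : borel_rV R d -> R) (Q : dyadic d).
Hypotheses (mf : measurable_fun setT f) (Qoo : (mu (cube R Q) < +oo)%E).
Local Notation T := (borel_rV R d).

Lemma measurable_oscillation (c r : R) : measurable ([set x | r < `|f x - c|] : set T).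
Proof.
have mg : measurable_fun setT (fun x : T => `|f x - c|).
  apply: measurableT_comp => //; apply: measurable_realfun.measurable_funB => //.
have := mg measurableT _ (measurable_itv `]r, +oo[).
rewrite setTI; congr (measurable _); apply/seteqP; split=> x /=;
  by rewrite in_itv /= andbT.
Qed.

Let mQ : measurable (cube R Q : set T). Proof. exact: measurable_cube. Qed.
Let finQ : mu (cube R Q) \is a fin_num. Proof. by rewrite ge0_fin_numE. Qed.

(** If m were farther than r from c, one of the half-lines beyond m would
contain all values within r of c, hence more than half of the mass. *)
Lemma median_near (m c r eta : R) : (0 < mu (cube R Q))%E -> eta < 2^-1 ->
  is_median mu f Q m ->
  (mu (cube R Q `&` [set x | (r < `|f x - c|)%R]) <= eta%:E * mu (cube R Q))%E ->
  `|m - c| <= r.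
Proof.
move=> Q0 eta2 /(_ Q0)[mgt mlt] cr.
have far (B : set T) : measurable B ->
    cube R Q `&` [set x | `|f x - c| <= r] `<=` B ->
    (mu (cube R Q `&` B) <= (2^-1)%:E * mu (cube R Q))%E -> False.
  move=> mB QB B2.
  have : (mu (cube R Q) <= (2^-1)%:E * mu (cube R Q) + eta%:E * mu (cube R Q))%E.
    apply: le_trans (leeD B2 cr).
    have mO := measurable_oscillation c r.
    apply: le_trans (measureU2 _ _ _); try exact: measurableI.
    apply: le_measure_sub => //; first by apply: measurableU; exact: measurableI.
    move=> x Qx; have [xr|xr] := ltrP r `|f x - c|; first by right.
    by left; split=> //; apply: QB.
  move: Q0; rewrite -(fineK finQ) -!EFinM -EFinD lte_fin lee_fin; nra.
have mf_lt c' : measurable ([set x | f x < c'] : set T).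
  have := mf measurableT (measurable_itv `]-oo, c'[).
  by rewrite setTI; congr (measurable _); apply/seteqP; split=> x /=; rewrite in_itv.
have mf_gt c' : measurable ([set x | c' < f x] : set T).
  have := mf measurableT (measurable_itv `]c', +oo[).
  rewrite setTI; congr (measurable _); apply/seteqP.
  by split=> x /=; rewrite in_itv /= andbT.
rewrite leNgt ltr_normr; apply/negP => /orP[rm|rm].
  apply: (far _ (mf_lt m)) => // x [_] /=; rewrite ler_norml => /andP[_].
  lra.
apply: (far _ (mf_gt m)) => // x [_] /=; rewrite ler_norml => /andP[+ _].
lra.
Qed.

(** Without this the infimum would be that of the empty set, which is 0 by
convention and carries no information.  It holds because the sets where
|f - c| > n decrease to the empty set in a cube of finite measure. *)
Lemma rel_med_osc_nonempty (lambda c : R) : 0 < lambda ->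
  [set r : R | 0 <= r /\
    (mu (cube R Q `&` [set x | (r < `|f x - c|)%R]) <= lambda%:E * mu (cube R Q))%E]
  !=set0.
Proof.
move=> l0; have [Q0|Q0] := eqVneq (mu (cube R Q)) 0%E.
  exists 0; split=> //; rewrite Q0 mule0 -Q0; apply: le_measure_sub => //.
  by apply: measurableI => //; exact: measurable_oscillation.
have fQ0 : 0 < fine (mu (cube R Q)) by rewrite fine_gt0// lt0e Q0 measure_ge0.
pose B n : set T := ~` [set x | n%:R < `|f x - c|].
have mB n : measurable (B n) by apply: measurableC; exact: measurable_oscillation.
have ndB : nondecreasing_seq B.
  move=> i j ij; apply/subsetPset => x; apply: contra_not => /=.
  by apply: le_lt_trans; rewrite ler_nat.
have [n] := bigcup_setD_small mQ Qoo mB ndB (mulr_gt0 l0 fQ0).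
rewrite (_ : \bigcup_k B k = setT) ?setTD ?setCK; last first.
  apply/seteqP; split=> // x _; exists (Num.bound `|f x - c|) => //=.
  by apply/negP; rewrite -leNgt ltW// archi_boundP.
by exists n%:R; split=> //; rewrite -(fineK finQ) -EFinM.
Qed.

Lemma rel_med_osc_ge0 (lambda : R) (g : T -> R) : 0 <= rel_med_osc mu lambda g Q.
Proof.
rewrite /rel_med_osc; set S := [set r | _].
have [->|/set0P S0] := eqVneq S set0; first by rewrite inf0.
by apply: lb_le_inf => // r [].
Qed.

Lemma med_osc_ge0 (lambda : R) : 0 <= med_osc mu lambda f Q.
Proof.
apply: lb_le_inf; first by exists (rel_med_osc mu lambda (fun x => f x - 0) Q), 0.
by move=> _ [c _ <-]; exact: rel_med_osc_ge0.
Qed.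

(** A nearly optimal centre c with radius r < w + e satisfies |m - c| <= r by
[median_near], so |f - m| > 2 (w + e) forces |f - c| > r.  Letting e tend to 0
uses continuity from below, since the strict inequality |f - m| > 2 w is an
increasing union. *)
Lemma median_concentration (m lambda : R) : 0 < lambda < 2^-1 ->
  is_median mu f Q m ->
  (mu (cube R Q `&` [set x | (2 * med_osc mu lambda f Q < `|f x - m|)%R])
     <= lambda%:E * mu (cube R Q))%E.
Proof.
move=> /andP[l0 l2] medm; have mO c r := measurable_oscillation c r.
have [Q0|Q0] := eqVneq (mu (cube R Q)) 0%E.
  by rewrite Q0 mule0 -Q0; apply: le_measure_sub => //; exact: measurableI.
have {}Q0 : (0 < mu (cube R Q))%E by rewrite lt0e Q0 measure_ge0.
set w := med_osc mu lambda f Q.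
have near e : 0 < e ->
    (mu (cube R Q `&` [set x | (2 * (w + e) < `|f x - m|)%R]) <=
     lambda%:E * mu (cube R Q))%E.
  move=> e0; have we : w < w + e by rewrite ltrDl.
  have [|_ [c _ <-] /inf_lt[]] := inf_lt _ we.
  - by exists (rel_med_osc mu lambda (fun x => f x - 0) Q), 0.
  - exact: rel_med_osc_nonempty.
  move=> r [r0 cr] rwe.
  have mc : `|m - c| <= r by exact: median_near cr.
  apply: le_trans cr.
  apply: le_measure_sub; try exact: measurableI.
  move=> x [Qx /= xm]; split=> //=.
  have := ler_distD c (f x) m; rewrite (distrC c m); lra.
pose B n : set T := [set x | 2 * (w + n.+1%:R^-1) < `|f x - m|].
have ndB : nondecreasing_seq B.
  move=> i j ij; apply/subsetPset => x /=; apply: le_lt_trans.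
  by rewrite ler_pM2l// lerD2l lef_pV2 ?posrE// ler_nat.
have UB : \bigcup_n B n = [set x | 2 * w < `|f x - m|].
  apply/seteqP; split=> x /=.
    by move=> [n _] /=; apply: le_lt_trans; rewrite ler_pM2l// lerDl.
  rewrite -subr_gt0 => xw; pose e := (`|f x - m| - 2 * w) / 2.
  have e0 : 0 < e by rewrite divr_gt0.
  have [n _ /(_ n (leqnn _))] := near_infty_natSinv_lt (PosNum e0).
  rewrite /= /e => ne; exists n => //; rewrite /B /=.
  by move: (n.+1%:R^-1) ne => t; lra.
rewrite -UB; apply/lee_addgt0Pr => e e0.
have mB n : measurable (B n) by exact: mO.
have mUB : measurable (\bigcup_n B n) by exact: bigcupT_measurable.
have [n Bn] := bigcup_setD_small mQ Qoo mB ndB e0.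
have nn : (mu (cube R Q `&` B n) <= lambda%:E * mu (cube R Q))%E.
  by apply: near; rewrite invr_gt0.
apply: le_trans (leeD nn Bn).
have mUD : measurable (\bigcup_k B k `\` B n) by exact: measurableD.
apply: le_trans (measureU2 _ _ _); try exact: measurableI.
apply: le_measure_sub; first exact: measurableI.
  by apply: measurableU; exact: measurableI.
move=> x [Qx Bx]; have [xn|xn] := EM (B n x); first by left.
by right.
Qed.

End median_oscillation.

(** * Pointwise domination *)

Lemma le_sum_esum_inj (R : realType) (I : choiceType) (F : set I) (a : I -> R)
    (n : nat) (p : pred nat) (b : nat -> I) : injective b ->
  (forall j, p j -> F (b j)) ->
  ((\sum_(j < n | p j) a (b j))%:E <= \esum_(i in F) (a i)%:E)%E.
Proof.
move=> binj bF; apply: esum_ge.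
exists [set` [fset b (val j) | j in 'I_n & p (val j)]%fset].
  split; first exact: finite_fset.
  by move=> i /= /imfsetP[/= j]; rewrite inE => /bF + ->.
rewrite fsbig_finite//= set_fsetK big_imfset/=; last first.
  by move=> i j _ _ /binj/val_inj.
by rewrite big_filter big_enum_cond/= -sumEFin.
Qed.

Section domination.
Variables (R : realType) (d : nat) (mu : {measure set (borel_rV R d) -> \bar R}).
Variables (f : borel_rV R d -> R) (lambda eta : R).
Variables (F0 : dyadic d) (m : dyadic d -> R).
Hypotheses (lf : locally_finite_measure mu) (mf : measurable_fun setT f).
Hypotheses (lambda0 : 0 < lambda) (lambda_eta : lambda < eta) (eta2 : eta < 2^-1).
Hypothesis med : forall Q : dyadic d, is_median mu f Q (m Q).

Definition excess (Q : dyadic d) : set (borel_rV R d) :=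
  [set x | (2 * med_osc mu lambda f Q < `|f x - m Q|)%R].

Definition oscillation (Q : dyadic d) : R :=
  med_osc mu lambda f Q + `|m Q - m (parent Q)|.

Local Notation host_at := (host_at mu F0 excess eta).
Local Notation branch := (branch F0).

(** The term 2 w(T_n) on the left makes the induction close: at the next stop it
pays for the distance from m(T_n) to the median of the cube just above. *)
Lemma host_at_telescope n x : cube R F0 x ->
  `|m (host_at n x) - m (parent F0)| + 2 * med_osc mu lambda f (host_at n x) <=
  2 * \sum_(j < n.+1 | host_at j x == branch j x) oscillation (branch j x).
Proof.
move=> F0x; have w0 Q : 0 <= med_osc mu lambda f Q by exact: med_osc_ge0.
have fin Q : (mu (cube R Q) < +oo)%E by exact: cube_finite.
elim: n => [|n IH].
  rewrite big_mkcond big_ord1 /= eqxx /host_at /= branch0// /oscillation.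
  by have := normr_ge0 (m F0 - m (parent F0)); lra.
rewrite big_mkcond big_ord_recr -big_mkcond mulrDr /=.
case: eqVneq => [tn|]; last first.
  rewrite {1}host_atS [in host_at n.+1 x]host_atS.
  by case: ifP => _; rewrite ?eqxx// mulr0 addr0.
have fn := stop_fires tn; rewrite tn.
(* Firing is a strict inequality, so the new cube has positive measure; hence
so does its parent, and the medians of both are genuine. *)
have Q1pos : (0 < mu (cube R (branch n.+1 x)))%E.
  apply: lt_le_trans (le_lt_trans _ fn) _.
    by apply: mule_ge0 => //; rewrite lee_fin ltW// (lt_trans lambda0).
  by apply: measureIl; [exact: measurable_cube|exact: measurable_oscillation].
have Qpos : (0 < mu (cube R (branch n x)))%E.
  apply: lt_le_trans Q1pos _; apply: le_measure_sub; try exact: measurable_cube.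
  exact: le_branch.
have jump : `|m (branch n x) - m (host_at n x)| <=
    2 * med_osc mu lambda f (host_at n x).
  apply: (median_near mf (fin _) Qpos eta2 (@med _)).
  apply: (@host_at_density R d mu F0 excess eta lambda) => //.
  move=> Q _; apply: median_concentration => //.
  by rewrite lambda0 (lt_trans lambda_eta).
rewrite /oscillation branch_parent in IH *.
have := ler_distD (m (branch n x)) (m (branch n.+1 x)) (m (parent F0)).
have := ler_distD (m (host_at n x)) (m (branch n x)) (m (parent F0)).
move: (w0 (branch n.+1 x)) (normr_ge0 (m (branch n.+1 x) - m (branch n x))).
by move: (\sum_(_ < _ | _) _) IH jump => S; lra.
Qed.

End domination.

Theorem theorem1p3 (R : realType) :
  exists2 C : R, 0 < C &
  forall (d : nat) (mu : {measure set (borel_rV R d) -> \bar R})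
    (f : borel_rV R d -> R) (lambda : R) (F0 : dyadic d) (m : dyadic d -> R),
  (0 < d)%N ->
  locally_finite_measure mu ->
  measurable_fun [set: borel_rV R d] f ->
  0 < lambda < 2^-1 ->
  (forall Q : dyadic d, is_median mu f Q (m Q)) ->
  exists F : set (dyadic d),
    [/\ forall Q, F Q -> cube R Q `<=` cube R F0,
        sparse mu F &
        {ae mu, forall x : borel_rV R d,
          ((`|f x - m (parent F0)| * \1_(cube R F0) x)%:E <=
           C%:E * \esum_(Q in F)
             ((med_osc mu lambda f Q + `|m Q - m (parent Q)|)
                * \1_(cube R Q) x)%:E)%E}].
Proof.
exists 2 => // d mu f lambda F0 m d0 lf mf /andP[l0 l2] med.
pose eta := (lambda + 2^-1) / 2.
have lambda_eta : lambda < eta by rewrite /eta; lra.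
have eta2 : eta < 2^-1 by rewrite /eta; lra.
have eta1 : eta < 1 by lra.
pose E := excess mu f lambda m.
have mE Q : measurable (E Q) by exact: measurable_oscillation.
have fin Q : (mu (cube R Q) < +oo)%E by exact: cube_finite.
have E_small Q : cube R Q `<=` cube R F0 ->
    (mu (cube R Q `&` E Q) <= lambda%:E * mu (cube R Q))%E.
  by move=> _; apply: median_concentration => //; rewrite l0.
exists (stopped mu F0 E eta); split.
- by move=> Q; exact: stopped_sub.
- exact: (stopped_sparse mE l0 lambda_eta E_small).
apply: filterS (ae_escape mE l0 lambda_eta eta1 (fin F0) E_small) => x escape.
have osc0 Q : 0 <= med_osc mu lambda f Q + `|m Q - m (parent Q)|.
  by rewrite addr_ge0// med_osc_ge0.
have [F0x|nF0x] := EM (cube R F0 x); last first.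
  rewrite indicE memNset// mulr0 mule_ge0//; apply: esum_ge0 => Q _.
  by rewrite lee_fin mulr_ge0.
have [n xE] := escape F0x; rewrite indicE mem_set// mulr1.
have {}xE : `|f x - m (host_at mu F0 E eta n x)| <=
    2 * med_osc mu lambda f (host_at mu F0 E eta n x).
  by rewrite leNgt; apply/negP.
pose a Q := (med_osc mu lambda f Q + `|m Q - m (parent Q)|) * \1_(cube R Q) x.
have aE j : a (branch F0 j x) = oscillation mu f lambda m (branch F0 j x).
  by rewrite /a indicE mem_set ?mulr1//; exact: cube_branch.
(* The cubes of the branch have distinct generations, so the stopped ones are
distinct members of the family. *)
have := @le_sum_esum_inj R _ (stopped mu F0 E eta) a n.+1
  (fun j => host_at mu F0 E eta j x == branch F0 j x) (branch F0 ^~ x).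
move=> /(_ (@branch_inj _ _ F0 x)) h.
apply: le_trans (lee_wpmul2l _ (h _)); last first.
- move=> j /eqP tj; apply/(stoppedP _ _ _ _ (cube_branch F0 j x)).
  by exists j.
- by rewrite lee_fin.
rewrite -EFinM lee_fin (eq_bigr _ (fun (j : 'I_n.+1) _ => aE j)).
have := host_at_telescope lf mf l0 lambda_eta eta2 med n F0x.
have := ler_distD (m (host_at mu F0 E eta n x)) (f x) (m (parent F0)).
by move: xE; rewrite /E; lra.
Qed.
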